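(* Let $p,q,r$ be pairwise distinct primes, $\alpha,\beta,\gamma\geq 1$ integers, $m\in\{p^{\alpha}q^{\beta},\,p^{\alpha}q^{\beta}r^{\gamma}\}$, and $\Gamma=\mathrm{Cay}(\mathbb{Z}_{p}\times\mathbb{Z}_{m},\Phi)$ with $\Phi=\varphi_p\times\varphi_m$. Then (1) $\mathrm{diam}(\Gamma)=3$ if one of the prime factors of $m$ is $2$; (2) $\mathrm{diam}(\Gamma)=2$ if all prime factors of $m$ are at least $3$.
   Context: For $n\geq 1$, $\mathbb{Z}_n=\{0,\dots,n-1\}$ is the integers mod $n$ and $\varphi_n$ is the set of elements of $\mathbb{Z}_n$ coprime to $n$ ($\varphi_p=\mathbb{Z}_p\setminus\{0\}$ for $p$ prime). $\mathrm{Cay}(\mathbb{Z}_p\times\mathbb{Z}_m,\varphi_p\times\varphi_m)$ is the graph on $\mathbb{Z}_p\times\mathbb{Z}_m$ where $(u,v)\sim(u',v')$ iff $u-u'\in\varphi_p$ and $v-v'\in\varphi_m$. The diameter of a connected graph is the maximum distance between two vertices; by convention, the diameter of a disconnected graph is the maximum of the diameters of its connected components. *)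

(* Defs.v *)
From HB Require Import structures.
From mathcomp Require Import all_boot all_order all_algebra.

Set Implicit Arguments.
Unset Strict Implicit.
Unset Printing Implicit Defensive.

Import GRing.Theory.

Section Graph.

Variables (T : finType) (e : rel T).

Definition walk_of_length (x y : T) (n : nat) : bool :=
  [exists w : n.-tuple T, path e x w && (last x w == y)].

(* A shortest walk repeats no vertex, so it has fewer than #|T| edges; hence  *)
(* this is the length of a shortest walk when x and y are connected, and the  *)
(* junk value #|T| otherwise (see gdistP).                                    *)
Definition gdist (x y : T) : nat :=
  find (walk_of_length x y) (iota 0 #|T|).

Definition component (x : T) : {set T} := [set y | connect e x y].

Definition components : {set {set T}} := [set component x | x : T].

Definition component_diam (C : {set T}) : nat :=
  \max_(x in C) \max_(y in C) gdist x y.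

Definition diam : nat := \max_(C in components) component_diam C.

Lemma gdistP (x y : T) : connect e x y ->
  walk_of_length x y (gdist x y) /\
  forall w, path e x w -> last x w = y -> gdist x y <= size w.
Proof.
move=> cxy.
have [w [ew lw uw]] : exists w, [/\ path e x w, y = last x w & uniq (x :: w)].
  case/connectP: cxy => w0 ew0 ->; case/shortenP: ew0 => w ew uw _.
  by exists w.
have hs : size w < #|T| by rewrite -[(size w).+1]/(size (x :: w)) -(card_uniqP uw) max_card.
have walkI v : path e x v -> last x v = y -> walk_of_length x y (size v).
  by move=> ev lv; apply/existsP; exists (in_tuple v); rewrite /= ev lv eqxx.
have hh : has (walk_of_length x y) (iota 0 #|T|).
  by apply/hasP; exists (size w); rewrite ?mem_iota //; apply: walkI.
split.
  have := nth_find 0 hh; rewrite nth_iota //.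
  by move: hh; rewrite has_find size_iota.
move=> v ev lv; rewrite leqNgt; apply/negP => lt_v.
have := before_find 0 lt_v; rewrite nth_iota ?add0n ?walkI //.
by apply: leq_trans lt_v _; rewrite -[X in _ <= X](size_iota 0) find_size.
Qed.

End Graph.

HB.instance Definition _ (U V : finZmodType) := GRing.Zmodule.on (U * V)%type.

Definition Cay (G : finZmodType) (S : {set G}) : rel G :=
  fun x y => (x - y)%R \in S.

Arguments Cay G S : clear implicits.

(* 'Z_n is the integers mod n only for n >= 2, the only case in use.          *)
Definition phi (n : nat) : {set 'Z_n} := [set x : 'Z_n | coprime x n].

(* Main.v *)
(* Adjacency flips the parity of each coordinate whose modulus is even, and
   these parities are the only obstruction to short walks: modulo n, every x
   (every even x, if n is even) is a sum of two units.  Hence two vertices of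
   one component are at distance at most 2, or, when m is even and their second
   coordinates have different parities, at most 3: subtract (1, 1) first.  A
   difference (0, 1), or (1, q) when p = 2, is not in the connection set, which
   makes the bounds sharp. *)
Require Import Defs.
From mathcomp Require Import all_boot all_order all_algebra.

Set Implicit Arguments.
Unset Strict Implicit.
Unset Printing Implicit Defensive.

Import GRing.Theory.

(** * Diameter bounds in a finite graph *)

Section Diameter.

Variables (T : finType) (e : rel T).

Lemma gdist_leq (x y : T) (w : seq T) :
  path e x w -> last x w = y -> gdist e x y <= size w.
Proof.
move=> ew lw; have cxy : connect e x y by apply/connectP; exists w.
by have [_] := gdistP cxy; apply.
Qed.

Lemma walk_gdist (x y : T) (n : nat) :
  (exists w, [/\ path e x w, last x w = y & size w = n]) ->
  connect e x y /\ gdist e x y <= n.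
Proof.
case=> w [ew lw <-]; split; last exact: gdist_leq.
by apply/connectP; exists w.
Qed.

Lemma gdist_path (x y : T) : connect e x y ->
  exists w, [/\ path e x w, last x w = y & size w = gdist e x y].
Proof.
case/gdistP=> /existsP[w /andP[ew /eqP lw]] _.
by exists w; rewrite size_tuple.
Qed.

Lemma gdist_leq_diam (x y : T) : connect e x y -> gdist e x y <= diam e.
Proof.
move=> cxy.
apply: (bigmax_sup (component e x)); first exact: imset_f.
apply: (bigmax_sup x); first by rewrite inE connect0.
by apply: (bigmax_sup y); rewrite ?inE.
Qed.

(** Members of a component are only known to be reachable from its base point [z]; symmetry joins
    them to each other through [z]. *)
Lemma diam_leq (k : nat) : connect_sym e ->
  (forall x y, connect e x y -> gdist e x y <= k) -> diam e <= k.
Proof.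
move=> symc lek; apply/bigmax_leqP=> _ /imsetP[z _ ->].
apply/bigmax_leqP=> x; rewrite inE => czx.
apply/bigmax_leqP=> y; rewrite inE => czy.
by apply: lek; apply: connect_trans czy; rewrite symc.
Qed.

End Diameter.

(** * Short walks in Cayley graphs *)

Section Cayley.

Variables (G : finZmodType) (S : {set G}).
Local Open Scope ring_scope.

Lemma Cay_connect_sym :
  (forall s, s \in S -> - s \in S) -> connect_sym (Cay G S).
Proof.
move=> SN; apply: sym_connect_sym => x y; rewrite /Cay.
by apply/idP/idP => /SN; rewrite opprB.
Qed.

Lemma Cay_walk2 (x y s t : G) : s \in S -> t \in S -> x - y = s + t ->
  exists w, [/\ path (Cay G S) x w, last x w = y & size w = 2%N].
Proof.
move=> Ss St Dxy; exists [:: x - s; y]; split=> //=.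
by rewrite /Cay subKr Ss addrAC Dxy addrC addKr St.
Qed.

Lemma Cay_walk3 (x y s t u : G) :
  s \in S -> t \in S -> u \in S -> x - y = s + (t + u) ->
  exists w, [/\ path (Cay G S) x w, last x w = y & size w = 3%N].
Proof.
move=> Ss St Su Dxy.
have [|w [ew lw sw]] := @Cay_walk2 (x - s) y t u St Su.
  by rewrite addrAC Dxy addrC addKr.
exists (x - s :: w); split=> //=; last by rewrite sw.
by rewrite {1}/Cay subKr Ss.
Qed.

End Cayley.

(** * Residues as sums of two units *)

Lemma coprime_primes (b n : nat) : 0 < n ->
  (forall l, prime l -> l %| n -> ~~ (l %| b)) -> coprime b n.
Proof.
move=> n0 nb; case: (ltngtP (gcdn b n) 1) => [|g1|/eqP//].
  by rewrite ltnNge gcdn_gt0 n0 orbT.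
have lg := pdiv_dvd (gcdn b n); have := nb _ (pdiv_prime g1).
rewrite (dvdn_trans lg (dvdn_gcdl _ _)).
by rewrite (dvdn_trans lg (dvdn_gcdr _ _)) => /(_ isT).
Qed.

(* Modulo a prime divisor l of n, the witness w + n`_(\pi(w)^') is congruent to
   w if l does not divide w, and to a unit otherwise. *)
Lemma coprime_pair_diff (n w : nat) : 0 < n -> 0 < w -> odd n || ~~ odd w ->
  exists a, coprime a n && coprime (a + w) n.
Proof.
move=> n0 w0 par; pose t := n`_(\pi(w)^'); exists (w + t).
have key l : prime l -> l %| n -> ~~ (l %| w + t) /\ ~~ (l %| w + t + w).
  move=> pl ln; case lw: (l %| w).
    have lt : ~~ (l %| t).
      apply/negP => lt; have := pnat_dvd lt (part_pnat _ _).
      by rewrite pnatE // !inE /= mem_primes pl w0 lw.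
    by rewrite (dvdn_addl _ lw) (dvdn_addr _ lw).
  have lpi : \pi(w)^'.-nat l by rewrite pnatE // !inE /= mem_primes pl w0 lw.
  have lt : l %| t by rewrite -(part_pnat_id lpi) partn_dvd.
  rewrite dvdn_addl // lw addnAC dvdn_addl // addnn -muln2 Euclid_dvdM // lw /=.
  (* Only [l = 2] could divide [2w]; then [n] is even, so [par] makes [w] even, contrary to [lw]. *)
  split=> //; apply/negP; rewrite dvdn_prime2 // => /eqP l2.
  by move: par ln lw; rewrite l2 !dvdn2 => /orP[->|->].
by apply/andP; split; apply: coprime_primes => // l pl ln; case: (key l pl ln).
Qed.

Section UnitsMod.

Variables (n : nat) (n_gt1 : 1 < n).
Implicit Types x y : 'Z_n.
Local Open Scope ring_scope.

Lemma mem_phi x : (x \in phi n) = (x \is a GRing.unit).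
Proof. by rewrite inE -{2}(natr_Zp x) unitZpE // coprime_sym. Qed.

Lemma phi_sum2 x : odd n || ~~ odd x ->
  exists a b, [/\ a \in phi n, b \in phi n & x = a + b].
Proof.
move=> par; have n0 : (0 < n)%N := ltnW n_gt1.
have [w [w0 parw xw]] : exists w : nat,
    [/\ (0 < w)%N, odd n || ~~ odd w & x = w%:R].
  case: (posnP x) => [x0|x0]; last by exists x; rewrite natr_Zp.
  (* The residue 0 is represented by [n], as [w] must be positive; the parity condition holds for
     [n] in either case. *)
  exists n; split=> //; first by case: odd.
  by apply: val_inj; rewrite /= val_Zp_nat // modnn.
have [a /andP[ca cb]] := coprime_pair_diff n0 w0 parw.
(* The difference of units [(a + w) - a] is a sum of units, since negation preserves units. *)
exists (a + w)%N%:R, (- a%:R); rewrite !mem_phi unitrN !unitZpE //.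
rewrite coprime_sym cb coprime_sym ca; split=> //.
by rewrite natrD addrAC subrr add0r.
Qed.

Hypothesis n_even : ~~ odd n.

(** Reduction modulo an even [n] keeps parity; this makes parity additive on ['Z_n]. *)
Lemma odd_Zp_nat (k : nat) : odd (k%:R : 'Z_n)%R = odd k.
Proof. by rewrite val_Zp_nat // odd_mod //; apply/negbTE. Qed.

Lemma odd_ZpD x y : odd (x + y : 'Z_n)%R = odd x (+) odd y.
Proof.
by rewrite -(natr_Zp x) -(natr_Zp y) -natrD !odd_Zp_nat oddD.
Qed.

Lemma odd_ZpB x y : odd (x - y : 'Z_n)%R = odd x (+) odd y.
Proof. by rewrite -[in RHS](subrK y x) [in RHS]odd_ZpD addbK. Qed.

Lemma odd_phi x : x \in phi n -> odd x.
Proof.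
rewrite inE => /eqP g1; apply: contraT => ex.
by have := dvdn_gcd 2 x n; rewrite g1 !dvdn2 ex n_even.
Qed.

End UnitsMod.

(** * Walks and diameter in the product graph *)

Section UnitProductGraph.

Variables (p m : nat) (p_gt1 : 1 < p) (m_gt1 : 1 < m).
Local Open Scope ring_scope.
Local Notation G := ('Z_p * 'Z_m)%type.
Local Notation S := (setX (phi p) (phi m)).
Local Notation E := (Cay G S).
Implicit Types x y : G.

Lemma mem_setX_phi x : (x \in S) = (x.1 \in phi p) && (x.2 \in phi m).
Proof. by case: x => x1 x2; rewrite in_setX. Qed.

Lemma mem_setX_unit x :
  (x \in S) = (x.1 \is a GRing.unit) && (x.2 \is a GRing.unit).
Proof. by rewrite mem_setX_phi !mem_phi. Qed.

Lemma phi_connect_sym : connect_sym E.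
Proof. by apply: Cay_connect_sym => s; rewrite !mem_setX_unit /= !unitrN. Qed.

Lemma phi_walk2 x y :
  odd p || ~~ odd (x.1 - y.1 : 'Z_p)%R ->
  odd m || ~~ odd (x.2 - y.2 : 'Z_m)%R ->
  exists w, [/\ path E x w, last x w = y & size w = 2%N].
Proof.
move=> /(phi_sum2 p_gt1)[a [b [pa pb ab]]] /(phi_sum2 m_gt1)[c [d [pc pd cd]]].
apply: (@Cay_walk2 _ S x y (a, c) (b, d));
  rewrite ?mem_setX_phi /= ?pa ?pb ?pc ?pd //.
by rewrite -[RHS]/(a + b, c + d) -ab -cd.
Qed.

Lemma phi_walk3 x y :
  odd p || odd (x.1 - y.1 : 'Z_p)%R ->
  odd m || odd (x.2 - y.2 : 'Z_m)%R ->
  exists w, [/\ path E x w, last x w = y & size w = 3%N].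
Proof.
(* Subtracting the unit 1 makes an odd residue modulo an even [n] even, hence a sum of two units. *)
have shift n (z : 'Z_n) : (1 < n)%N -> odd n || odd z ->
    odd n || ~~ odd (z - 1 : 'Z_n)%R.
  move=> n1; have [//|en] := boolP (odd n); rewrite !orFb => oz.
  by rewrite odd_ZpB // oz -[1]/(1%:R) odd_Zp_nat.
move=> /(shift _ _ p_gt1)/(phi_sum2 p_gt1)[a [b [pa pb ab]]].
move=> /(shift _ _ m_gt1)/(phi_sum2 m_gt1)[c [d [pc pd cd]]].
apply: (@Cay_walk3 _ S x y (1, 1) (a, c) (b, d));
  rewrite ?mem_setX_phi /= ?pa ?pb ?pc ?pd //.
  by rewrite !mem_phi // !unitr1.
by rewrite -[RHS]/(1 + (a + b), 1 + (c + d)) -ab -cd !(addrC 1) !subrK.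
Qed.

Lemma odd_phi_path x w : ~~ odd m -> path E x w ->
  odd (last x w).2 = odd x.2 (+) odd (size w).
Proof.
move=> m_even; elim: w x => [|z w IHw] x /=; first by rewrite addbF.
case/andP; rewrite {1}/Cay mem_setX_phi => /andP[_ /(odd_phi m_even)].
rewrite odd_ZpB // => xz /IHw ->.
by move: xz; do 3!case: odd.
Qed.

(** Every edge flips both parities, so their sum is constant on a component. *)
Lemma odd_phi_connect x y : ~~ odd p -> ~~ odd m -> connect E x y ->
  odd (x.1 - y.1 : 'Z_p)%R = odd (x.2 - y.2 : 'Z_m)%R.
Proof.
move=> p_even m_even /connectP[w ew ->]; rewrite !odd_ZpB //.
elim: w x ew => [|z w IHw] x /=; first by rewrite !addbb.
case/andP; rewrite {1}/Cay mem_setX_phi.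
case/andP=> [/(odd_phi p_even) + /(odd_phi m_even)].
rewrite !odd_ZpB // => xz1 xz2 /IHw.
by move: xz1 xz2; do 6!case: odd.
Qed.

Lemma diam_phi_odd : odd p -> odd m -> diam E = 2%N.
Proof.
move=> op om; apply/eqP; rewrite eqn_leq; apply/andP; split.
  apply: diam_leq phi_connect_sym _ => x y _.
  by have [|_ //] := @walk_gdist _ E x y 2%N;
    apply: phi_walk2; rewrite ?op ?om.
(* The first coordinate keeps [x] from being adjacent to 0, the second keeps it distinct from 0. *)
pose x : G := (0, 1).
have [|cx _] := @walk_gdist _ E x 0 2%N;
  first by apply: phi_walk2; rewrite ?op ?om.
apply: leq_trans (gdist_leq_diam cx).
have [[|z [|z' w]] [ew lw <-]] // := gdist_path cx.
by move: ew; rewrite [z]lw [path _ _ _]andbT /Cay subr0 mem_setX_unit unitr0.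
Qed.

(** The vertex [x] gives the lower bound: the parity conditions join it to 0 by a walk of length 3,
    its odd second coordinate forces every such walk to have odd length, and [x \notin S] excludes
    length 1. *)
Lemma diam_phi_even x : ~~ odd m -> odd p || odd x.1 -> odd x.2 -> x \notin S ->
  diam E = 3%N.
Proof.
move=> m_even px mx xS; apply/eqP; rewrite eqn_leq; apply/andP; split.
  apply: diam_leq phi_connect_sym _ => y z cyz.
  (* For even [p] the two parities agree by connectedness, so the second alone decides between
     lengths 2 and 3. *)
  have parp : odd p || (odd (y.1 - z.1 : 'Z_p)%R == odd (y.2 - z.2 : 'Z_m)%R).
    by case op: (odd p) => //=; rewrite odd_phi_connect ?op.
  have [o2|e2] := boolP (odd (y.2 - z.2 : 'Z_m)%R).
    have [|_ //] := @walk_gdist _ E y z 3%N;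
      apply: phi_walk3; last by rewrite o2 orbT.
    by move: parp; rewrite o2 eqb_id.
  have [|_ le2] := @walk_gdist _ E y z 2%N; last exact: leq_trans le2 _.
  apply: phi_walk2; last by rewrite e2 orbT.
  by move: parp; rewrite (negbTE e2) eqbF_neg.
have [|cx _] := @walk_gdist _ E x 0 3%N.
  by apply: phi_walk3; rewrite ?(subr0 x.1) ?(subr0 x.2) ?mx ?orbT.
apply: leq_trans (gdist_leq_diam cx).
have [w [ew lw <-]] := gdist_path cx.
have := odd_phi_path m_even ew; rewrite lw mx /= => /esym/negbFE.
case: w ew lw => [|z [|z' [|z'' w]]] //= ew lw.
by move: ew; rewrite lw /Cay subr0 (negbTE xS).
Qed.

End UnitProductGraph.

Theorem theorem4p8 (p q r alpha beta gamma m : nat)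
  (p_prime : prime p) (q_prime : prime q) (r_prime : prime r)
  (neq_pq : p <> q) (neq_pr : p <> r) (neq_qr : q <> r)
  (alpha_ge1 : 1 <= alpha) (beta_ge1 : 1 <= beta) (gamma_ge1 : 1 <= gamma)
  (m_def : m = p ^ alpha * q ^ beta \/
           m = p ^ alpha * q ^ beta * r ^ gamma) :
  (2 \in primes m ->
     diam (Cay ('Z_p * 'Z_m)%type (setX (phi p) (phi m))) = 3) /\
  ((forall l : nat, l \in primes m -> 3 <= l) ->
     diam (Cay ('Z_p * 'Z_m)%type (setX (phi p) (phi m))) = 2).
Proof.
have [p_gt1 q_gt1] := (prime_gt1 p_prime, prime_gt1 q_prime).
have [m_gt0 pm qm] : [/\ 0 < m, p %| m & q %| m].
  have pa : p %| p ^ alpha by apply: dvdn_exp.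
  have qb : q %| q ^ beta by apply: dvdn_exp.
  by case: m_def => ->; split;
    rewrite ?muln_gt0 ?expn_gt0 ?prime_gt0 // -?mulnA;
    do ?[exact: dvdn_mulr | exact: dvdn_mull | apply: dvdn_mull].
have m_gt1 : 1 < m by apply: leq_trans p_gt1 (dvdn_leq m_gt0 pm).
split=> [|ge3].
  rewrite mem_primes m_gt0 dvdn2 /= => m_even.
  have [op|ep] := boolP (odd p).
    apply: (@diam_phi_even p m p_gt1 m_gt1 (0, 1)%R) => //=; rewrite ?op //.
    by rewrite mem_setX_unit //= unitr0.
  have p2 : p = 2 by case: (even_prime p_prime) => // op; rewrite op in ep.
  have oq : odd q.
    by case: (even_prime q_prime) => // q2; rewrite p2 q2 in neq_pq.
  (* Modulo 2 an odd first coordinate is a unit, so the second must be an odd non-unit: [q] is odd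
     and divides [m]. *)
  apply: (@diam_phi_even p m p_gt1 m_gt1 (1, q%:R)%R) => //=.
  - by rewrite orbT.
  - by rewrite odd_Zp_nat.
  - rewrite mem_setX_unit //= unitZpE // /coprime gcdnC; move/gcdn_idPl: qm => ->.
    by rewrite (gtn_eqF q_gt1) andbF.
have odd_dvd l : prime l -> l %| m -> odd l.
  move=> pl lm; have := ge3 l; rewrite mem_primes pl m_gt0 lm => /(_ isT).
  by case: (even_prime pl) => // ->.
apply: diam_phi_odd => //; first exact: odd_dvd.
apply: contraT; rewrite -dvdn2 => m2.
by have := odd_dvd 2 isT m2.
Qed.
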